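(* Let $(X,\mathcal U)$ be a uniform $P$-space. The following are equivalent: \begin{enumerate} \item $B_n$ is strongly functionally balanced for every $n\in\mathbb N$. \item $B_n$ is functionally balanced for every $n\in\mathbb N$. \item $F(X,\mathcal U)$ is functionally balanced. \item $F(X,\mathcal U)$ is strongly functionally balanced. \end{enumerate} Here $F(X,\mathcal U)$ is the uniform free topological group of $(X,\mathcal U)$ and $B_n\subseteq F(X,\mathcal U)$ is its subset of all words of length at most $n$.
   Context: All topological groups and uniform spaces are assumed to be Hausdorff, and $X$ is nonempty. A uniform $P$-space is a uniform space $(X,\mathcal U)$ such that the intersection of countably many elements of $\mathcal U$ is again in $\mathcal U$. Uniform free topological group: $F(X,\mathcal U)$ is a topological group together with a uniformly continuous map $i:X\to F(X,\mathcal U)$ such that for every topological group $G$ and every uniformly continuous map $\varphi:(X,\mathcal U)\to G$ there is a unique continuous homomorphism $\Phi:F(X,\mathcal U)\to G$ with $\Phi\circ i=\varphi$; topological groups carry here their two-sided uniformity $\mathcal L_G\vee\mathcal R_G$. It is known that $F(X,\mathcal U)$ exists, that $i$ is a uniform embedding, and that algebraically $F(X,\mathcal U)$ is the free group $F(X)$ on $X$ (identified with $i(X)$). $B_n$ denotes the set of all elements of $F(X)$ whose word length with respect to $X\cup X^{-1}$ is at most $n$. For a topological group $G$, the left uniformity $\mathcal L_G$ has as base the sets $\{(x,y)\in G^2: x^{-1}y\in U\}$, and the right uniformity $\mathcal R_G$ has as base the sets $\{(x,y)\in G^2: xy^{-1}\in U\}$, where $U$ runs over the neighborhoods of the identity.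 For a symmetric subset $B=B^{-1}\subseteq G$, let $\mathcal L_G^B=\{\delta\cap(B\times B):\delta\in\mathcal L_G\}$ and $\mathcal R_G^B=\{\delta\cap(B\times B):\delta\in\mathcal R_G\}$ be the traces on $B$. $B$ is functionally balanced (strongly functionally balanced) if every bounded (respectively, every) $\mathcal L_G^B$-uniformly continuous function $f:B\to\mathbb R$ is $\mathcal R_G^B$-uniformly continuous. The group $G$ is (strongly) functionally balanced if this holds for $B=G$. *)

(* Defs.v *)
From HB Require Import structures.
From mathcomp Require Import all_boot all_order all_algebra.
From mathcomp Require Import all_classical all_reals all_analysis.

Set Implicit Arguments.
Unset Strict Implicit.
Unset Printing Implicit Defensive.

Import Order.TTheory GRing.Theory Num.Theory.
Import numFieldNormedType.Exports.

Local Open Scope classical_set_scope.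
Local Open Scope group_scope.

(* The Hausdorff assumption is not part of this structure; it is stated with
   [hausdorff_space] wherever it is needed. *)
HB.mixin Record isTopologicalGroup G of Group G & Topological G := {
  mulg_continuous : continuous (fun xy : G * G => xy.1 * xy.2);
  invg_continuous : continuous (fun x : G => x^-1)
}.

#[short(type="topologicalGroupType")]
HB.structure Definition TopologicalGroup :=
  {G of isTopologicalGroup G & Group G & Topological G}.

Definition left_entourage (G : topologicalGroupType) : set_system (G * G) :=
  [set E | exists2 U : set G, nbhs 1 U &
    [set xy | U (xy.1^-1 * xy.2)] `<=` E].

Definition right_entourage (G : topologicalGroupType) : set_system (G * G) :=
  [set E | exists2 U : set G, nbhs 1 U &
    [set xy | U (xy.1 * xy.2^-1)] `<=` E].

(* The join of the left and right uniformities. *)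
Definition two_sided_entourage (G : topologicalGroupType) :
    set_system (G * G) :=
  [set E | exists A B : set (G * G),
    [/\ left_entourage A, right_entourage B & A `&` B `<=` E]].

(* The library's [unif_continuous], for uniformities that are not attached
   canonically to their carrier. *)
Definition unif_continuous_wrt (S T : Type) (E : set_system (S * S))
    (E' : set_system (T * T)) (f : S -> T) : Prop :=
  (fun xy => (f xy.1, f xy.2)) @ E --> E'.

(* The sets D `&` (B `*` B) with D in E, as relations on the type of elements
   of B. *)
Definition trace_entourage (S : Type) (B : set S) (E : set_system (S * S)) :
    set_system (B * B) :=
  [set [set xy : B * B | D (\val xy.1, \val xy.2)] | D in E].

Definition functionally_balanced (R : realType) (G : topologicalGroupType)
    (B : set G) : Prop :=
  forall f : B -> R, bounded_fun f ->
    unif_continuous_wrt (trace_entourage (@left_entourage G)) entourage f ->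
    unif_continuous_wrt (trace_entourage (@right_entourage G)) entourage f.

Definition strongly_functionally_balanced (R : realType)
    (G : topologicalGroupType) (B : set G) : Prop :=
  forall f : B -> R,
    unif_continuous_wrt (trace_entourage (@left_entourage G)) entourage f ->
    unif_continuous_wrt (trace_entourage (@right_entourage G)) entourage f.

Definition uniform_P_space (X : uniformType) : Prop :=
  forall E : nat -> set (X * X),
    (forall n, entourage (E n)) -> entourage (\bigcap_n E n).

Definition is_uniform_free_group (X : uniformType) (F : topologicalGroupType)
    (i : X -> F) : Prop :=
  [/\ hausdorff_space F,
      unif_continuous_wrt entourage (@two_sided_entourage F) i &
      forall (G : topologicalGroupType) (phi : X -> G),
        hausdorff_space G ->
        unif_continuous_wrt entourage (@two_sided_entourage G) phi ->
        exists! Phi : F -> G,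
          [/\ continuous Phi, {morph Phi : x y / x * y} & Phi \o i = phi]].

Definition word_ball (G : groupType) (S : set G) (n : nat) : set G :=
  [set g | exists s : seq G,
    [/\ (size s <= n)%N, forall x, x \in s -> S x \/ S x^-1 &
        g = \prod_(x <- s) x]].

(* Main.v *)
(* Equip the subgroup generated by [i X] with the traces of the countable
   intersections of neighborhoods of F. As X is a uniform P-space, i is still
   uniformly continuous into this finer group, so the universal property yields
   a continuous section of its inclusion into F. Hence F is generated by [i X]
   and countable intersections of neighborhoods of 1 in F are neighborhoods.
   In such a group, f : B -> R is left uniformly continuous iff f x = f y
   whenever x^-1 y lies in a suitable neighborhood of 1, which may be taken to
   be an open subgroup, and symmetrically on the right. Thus boundedness is
   irrelevant, neighborhoods obtained on the balls B_n can be intersected, and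
   functions on B_n extend to F along the cosets of an open subgroup. *)
From HB Require Import structures.
Require Import Defs.
From mathcomp Require Import all_boot all_order all_algebra.
From mathcomp Require Import all_classical all_reals all_analysis.

Set Implicit Arguments.
Unset Strict Implicit.
Unset Printing Implicit Defensive.

Import Order.TTheory GRing.Theory Num.Theory.
Import numFieldNormedType.Exports.

Local Open Scope classical_set_scope.
Local Open Scope group_scope.

(** Countably many conditions thus force equality of real values. In a group where countable
    intersections of neighborhoods of 1 are neighborhoods, this turns uniform continuity of a real
    function into exact equality on nearby points. *)
Lemma countable_separating_entourages (R : realType) :
  exists2 D : nat -> set (R * R),
  (forall n, entourage (D n)) & forall x y, (forall n, D n (x, y)) -> x = y.
Proof.
exists (fun n => [set xy | ball xy.1 (n.+1%:R^-1)%R xy.2]) => [n|x y Dxy].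
  exact: (entourage_ball _ (PosNum (_ : 0 < n.+1%:R^-1)%R)).
apply/eqP; rewrite -subr_eq0 -normr_le0; apply/ler_addgt0Pr => e e0.
have [N _ /(_ N (leqnn N)) /=] := near_infty_natSinv_lt (PosNum e0).
rewrite add0r => /ltW; apply: le_trans; apply: ltW; exact: (Dxy N).
Qed.

(** * Topological P-groups: open subgroups and uniform continuity *)

Definition P_group (G : topologicalGroupType) : Prop :=
  forall U : nat -> set G, (forall n, nbhs 1 (U n)) -> nbhs 1 (\bigcap_n U n).

Section UniformContinuityInPGroups.
Context (G : topologicalGroupType) (G_P : P_group G).

(** Iterating a shrinking [V] to [W] with [W^-1 * W] inside [V] gives a decreasing sequence of
    neighborhoods. Its intersection is closed under [x^-1 * y] and is still a neighborhood of 1. *)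
Lemma P_group_open_subgroup (U : set G) : nbhs 1 U ->
  exists H : set G, [/\ nbhs 1 H, H `<=` U &
    forall x y, H x -> H y -> H (x^-1 * y)].
Proof.
(* The hypothesis on [V] stands under the existential so that [choice] gives a function on all sets,
   which can be iterated from [U]. *)
have small (V : set G) : exists W : set G, nbhs 1 V ->
    [/\ nbhs 1 W, W `<=` V & forall x y, W x -> W y -> V (x^-1 * y)].
  have [V1|] := pselect (nbhs 1 V); last by exists set0.
  have mV : \forall x \near (1 : G) & y \near (1 : G), V (x * y).
    have := @mulg_continuous G (1, 1) V; rewrite /= mulg1 => /(_ V1).
    by case=> -[A B] [A1 B1] ABV; exists (A, B).
  have {}mV : \forall x \near (1 : G) & y \near (1 : G), V (x^-1 * y).
    case: mV => -[A B] [/= A1 B1] ABV.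
    exists ((fun x => x^-1) @^-1` A, B); last first.
      by move=> [x y] [/= Ax By]; exact: (ABV (_, _)).
    by split=> //=; apply: (@invg_continuous G 1); rewrite invg1.
  case: mV => -[A B] [/= A1 B1] ABV.
  exists (A `&` B `&` V) => _; split; first by do !apply: filterI.
    by move=> x [].
  by move=> x y [[Ax _] _] [[_ By] _]; exact: (ABV (_, _)).
move=> U1; have [s sP] := choice small; pose V n := iter n s U.
have V1 n : nbhs 1 (V n) by elim: n => //= n /sP[].
exists (\bigcap_n V n); split; [exact: G_P | by move=> x /(_ 0%N I)|].
move=> x y Vx Vy n _; have [_ _] := sP _ (V1 n).
by apply; [exact: (Vx n.+1)|exact: (Vy n.+1)].
Qed.

Context (R : realType) (B : set G).

(* With [q xy] equal to [xy.1^-1 * xy.2] or [xy.1 * xy.2^-1], the entourages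
   below are the left and the right ones. *)
Lemma P_group_unif_continuousP (q : G * G -> G) (f : B -> R) :
  unif_continuous_wrt (trace_entourage (B := B)
    [set E | exists2 U : set G, nbhs 1 U & [set xy | U (q xy)] `<=` E])
    entourage f <->
  exists2 U : set G, nbhs 1 U &
    forall x y : B, U (q (\val x, \val y)) -> f x = f y.
Proof.
split=> [fq|[U U1 fU] D eD].
  have [D eD D_eq] := countable_separating_entourages R.
  have /choice[U UP] n : exists U : set G, nbhs 1 U /\
      forall x y : B, U (q (\val x, \val y)) -> D n (f x, f y).
    have [E [U U1 UE] EE] := fq _ (eD n).
    exists U; split=> // x y Uxy.
    suff : ((fun xy => (f xy.1, f xy.2)) @^-1` D n) (x, y) by [].
  by rewrite -EE; exact: (UE (\val x, \val y)).
  exists (\bigcap_n U n); first by apply: G_P => n; have [] := UP n.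
  by move=> x y Uxy; apply: D_eq => n; apply: (UP n).2; exact: Uxy.
(* The preimage of [D] has to equal a trace, not merely contain one. This witness is the largest set
   of pairs with that trace: pairs outside [B * B] belong to it vacuously. *)
exists [set xy | forall a b : B, xy = (\val a, \val b) -> D (f a, f b)].
  exists U => // xy Uxy a b abE; rewrite abE in Uxy.
  by rewrite (fU _ _ Uxy); exact: entourage_refl.
apply/seteqP; split=> -[a b] /= Dab; first exact: Dab.
by move=> a' b' [/val_inj <- /val_inj <-].
Qed.

End UniformContinuityInPGroups.

(** * Functional balance of subsets of a P-group *)

Section BalanceInPGroups.
Context (R : realType) (G : topologicalGroupType) (G_P : P_group G).

Lemma P_group_left_unif_continuousP (B : set G) (f : B -> R) :
  unif_continuous_wrt (trace_entourage (@left_entourage G)) entourage f <->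
  exists2 U : set G, nbhs 1 U &
    forall x y : B, U ((\val x)^-1 * \val y) -> f x = f y.
Proof. exact: (P_group_unif_continuousP G_P (fun xy => xy.1^-1 * xy.2)). Qed.

Lemma P_group_right_unif_continuousP (B : set G) (f : B -> R) :
  unif_continuous_wrt (trace_entourage (@right_entourage G)) entourage f <->
  exists2 U : set G, nbhs 1 U &
    forall x y : B, U (\val x * (\val y)^-1) -> f x = f y.
Proof. exact: (P_group_unif_continuousP G_P (fun xy => xy.1 * xy.2^-1)). Qed.

Lemma strongly_functionally_balancedW (B : set G) :
  strongly_functionally_balanced R B -> functionally_balanced R B.
Proof. by move=> B_sfb f _; exact: B_sfb. Qed.

(* Uniform continuity only depends on the fibres of [f], so [f] may be composed
   with an injection of the line into [-1, 1]. *)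
Lemma P_group_functionally_balanced_strongly (B : set G) :
  functionally_balanced R B -> strongly_functionally_balanced R B.
Proof.
move=> B_fb f /P_group_left_unif_continuousP[U U1 fU].
have /(_ _ _)/P_group_right_unif_continuousP[||V V1 fV] :=
    B_fb (fun x => contract (f x)%:E).
- exists 1%R; split=> // M M1 x _ /=.
  exact: le_trans (contract_le1 (f x)%:E) (ltW M1).
- by apply/P_group_left_unif_continuousP; exists U => // x y /fU ->.
apply/P_group_right_unif_continuousP; exists V => // x y /fV.
by move=> /contract_inj[].
Qed.

(** Any two points lie in a common [B n], so the intersection of the neighborhoods found on the
    pieces serves all pairs at once. *)
Lemma functionally_balanced_bigcup (B : nat -> set G) :
  {homo B : m n / (m <= n)%N >-> m `<=` n} -> (forall x, exists n, B n x) ->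
  (forall n, functionally_balanced R (B n)) ->
  functionally_balanced R [set: G].
Proof.
move=> B_mono B_cover B_fb f [M [Mr f_bd]].
move=> /P_group_left_unif_continuousP[U U1 fU].
pose t x : [set: G] := exist _ x (mem_set I).
have /choice[V VP] n : exists V : set G, nbhs 1 V /\
    forall x y, B n x -> B n y -> V (x * y^-1) -> f (t x) = f (t y).
  have /(_ _ _)/P_group_right_unif_continuousP[||V V1 fV] :=
      B_fb n (fun x => f (t (\val x))).
  - by exists M; split=> // M' /f_bd f_M x _; exact: f_M.
  - apply/P_group_left_unif_continuousP; exists U => // x y Uxy.
    exact: (fU (t _) (t _) Uxy).
  exists V; split=> // x y Bx By.
  exact: (fV (exist _ x (mem_set Bx)) (exist _ y (mem_set By))).
apply/P_group_right_unif_continuousP; exists (\bigcap_n V n).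
  by apply: G_P => n; have [] := VP n.
move=> x y Vxy.
have [m Bx] := B_cover (\val x); have [n By] := B_cover (\val y).
have tE z : z = t (\val z) by exact: val_inj.
rewrite (tE x) (tE y); apply: (VP (maxn m n)).2; last exact: Vxy.
  exact: B_mono (leq_maxl _ _) _ Bx.
exact: B_mono (leq_maxr _ _) _ By.
Qed.

(* A function constant on the traces of the cosets [x H] of an open subgroup
   extends to all of [G] as a function constant on these cosets. *)
Lemma strongly_functionally_balanced_sub (B : set G) :
  strongly_functionally_balanced R [set: G] ->
  strongly_functionally_balanced R B.
Proof.
move=> G_sfb f /P_group_left_unif_continuousP[U U1 fU].
have [H [H1 HU HV]] := P_group_open_subgroup G_P U1.
have He : H 1 by exact: nbhs_singleton H1.
have HM x y : H x -> H y -> H (x * y).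
  move=> Hx Hy; rewrite -[x]invgK; apply: (HV) => //.
  by rewrite -[x^-1]mulg1; apply: (HV).
(* The default 0 is taken on the cosets that miss [B]. It does no harm: points in the same left
   coset of [H] either both fall under the default or both do not. *)
pose g (x : [set: G]) : R :=
  if pselect (exists b : B, H ((\val b)^-1 * \val x)) is left ex
  then f (projT1 (cid ex)) else 0%R.
have gE (b : B) (x : [set: G]) : H ((\val b)^-1 * \val x) -> g x = f b.
  move=> Hbx; rewrite /g; case: pselect => [ex|]; last by case; exists b.
  case: cid => c /= Hcx; apply: (fU); apply: (HU).
  suff -> : (\val c)^-1 * \val b =
      ((\val c)^-1 * \val x) * ((\val b)^-1 * \val x)^-1.
    apply: (HM) => //; rewrite -[_^-1]mulg1; exact: HV.
  by rewrite invgM invgK mulgA mulgK.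
have /(_ _)/P_group_right_unif_continuousP[|V V1 gV] := G_sfb g.
  apply/P_group_left_unif_continuousP; exists H => // x y Hxy.
  have Hyx : H ((\val y)^-1 * \val x).
    by rewrite -[X in H X]mulg1 -[_ * \val x]invgK invgM invgK; apply: (HV).
  have [[b Hbx]|nex] := pselect (exists b : B, H ((\val b)^-1 * \val x)).
    rewrite (gE _ _ Hbx) (@gE b) //.
    by have := HM _ _ Hbx Hxy; rewrite -mulgA mulVKg.
  rewrite /g; case: pselect => // _; case: pselect => // -[b Hby]; case: nex.
  by exists b; have := HM _ _ Hby Hyx; rewrite -mulgA mulVKg.
apply/P_group_right_unif_continuousP; exists V => // x y Vxy.
pose t (b : B) : [set: G] := exist _ (\val b) (mem_set I).
have gt b : g (t b) = f b by apply: gE; rewrite /= mulVg.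
by rewrite -!gt; exact: gV.
Qed.

End BalanceInPGroups.

(** * Word balls and the subgroup that they exhaust *)

Lemma word_ball_le (G : groupType) (S : set G) :
  {homo word_ball S : m n / (m <= n)%N >-> m `<=` n}.
Proof.
by move=> m n mn _ [s [sm sS ->]]; exists s; split=> //; exact: leq_trans mn.
Qed.

Definition generated (G : groupType) (S : set G) : {pred G} :=
  [pred x | `[< exists n, word_ball S n x >]].

Lemma generated_group_closed (G : groupType) (S : set G) :
  group_closed (generated S).
Proof.
split=> [|_ _ /asboolP[m [s [sm sS ->]]] /asboolP[n [t [tn tS ->]]]].
  by apply/asboolP; exists 0%N, [::]; rewrite big_nil.
apply/asboolP; exists (size s + size t)%N, (s ++ rev [seq x^-1 | x <- t]).
split; first by rewrite size_cat size_rev size_map.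
  move=> x; rewrite mem_cat mem_rev => /orP[/sS//|/mapP[y yt ->]].
  by rewrite invgK; case: (tS _ yt); [right|left].
rewrite big_cat; congr (_ * _).
elim: t {tn tS} => [|y t IH]; first by rewrite !big_nil invg1.
by rewrite big_cons invgM IH /= rev_cons -cats1 big_cat big_seq1.
Qed.

(** * The generated subgroup with its G-delta topology *)

Section GdeltaGenerated.
Context (G : topologicalGroupType) (S : set G).

Definition gdelta_generated : Type := {x : G | x \in generated S}.
Local Notation H := gdelta_generated.

HB.instance Definition _ := Choice.on H.
HB.instance Definition _ := SubChoice.on H.
HB.instance Definition _ :=
  SubChoice_isSubGroup.Build G (generated S) H (generated_group_closed S).

(** This is the P-modification (G-delta modification) of the topology of [G], traced on the
    subgroup. *)
Definition gdelta_nbhs (x : H) : set_system H :=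
  [set A | exists2 U : nat -> set G, (forall n, nbhs (\val x) (U n)) &
    \val @^-1` (\bigcap_n U n) `<=` A].

HB.instance Definition _ := hasNbhs.Build H gdelta_nbhs.

Fact gdelta_nbhs_filter (x : H) : ProperFilter (nbhs x).
Proof.
split.
  by case=> U Ux /(_ x); apply=> n _; exact: nbhs_singleton (Ux n).
split.
- by exists (fun=> setT) => // n; exact: filterT.
- move=> A B [U Ux UA] [V Vx VB]; exists (fun n => U n `&` V n).
    by move=> n; exact: filterI.
  by move=> y UVy; split; [apply: UA|apply: VB] => n /UVy[].
- by move=> A B AB [U Ux UA]; exists U => //; exact: subset_trans AB.
Qed.

Fact gdelta_nbhs_singleton (x : H) (A : set H) : nbhs x A -> A x.
Proof. by case=> U Ux; apply=> n _; exact: nbhs_singleton (Ux n). Qed.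

Fact gdelta_nbhs_nbhs (x : H) (A : set H) : nbhs x A -> nbhs x (nbhs^~ A).
Proof.
case=> U Ux UA; exists (fun n => (U n)^°) => [n|y Uy].
  exact: nbhs_interior.
by exists U => // n; exact: (Uy n I).
Qed.

HB.instance Definition _ := Nbhs_isNbhsTopological.Build H
  gdelta_nbhs_filter gdelta_nbhs_singleton gdelta_nbhs_nbhs.

Fact gdelta_mulg_continuous : continuous (fun xy : H * H => xy.1 * xy.2).
Proof.
move=> [x y] /= A [U Uxy UA].
have /choice[V VP] n : exists V : set G * set G,
    [/\ nbhs (\val x) V.1, nbhs (\val y) V.2 &
      forall a b, V.1 a -> V.2 b -> U n (a * b)].
  have /(_ (U n))[|V [V1 V2] VU] := @mulg_continuous G (\val x, \val y).
    exact: Uxy.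
  by exists V; split=> // a b Va Vb; exact: (VU (a, b)).
exists (\val @^-1` (\bigcap_n (V n).1), \val @^-1` (\bigcap_n (V n).2)).
  by split; [exists (fun n => (V n).1)|exists (fun n => (V n).2)] => // n;
    have [] := VP n.
move=> [a b] [/= Va Vb]; apply: UA => n _ /=.
by have [_ _] := VP n; apply; [exact: Va|exact: Vb].
Qed.

Fact gdelta_invg_continuous : continuous (fun x : H => x^-1).
Proof.
move=> x A [U Ux UA]; exists (fun n => (fun y => y^-1) @^-1` U n).
  by move=> n; apply: (@invg_continuous G); exact: Ux.
by move=> y Uy; apply: UA => n nT; exact: (Uy n nT).
Qed.

HB.instance Definition _ := isTopologicalGroup.Build H
  gdelta_mulg_continuous gdelta_invg_continuous.

Lemma gdelta_val_continuous : continuous (\val : H -> G).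
Proof. by move=> x A xA; exists (fun=> A) => // y /(_ 0%N I). Qed.

Lemma gdelta_hausdorff : hausdorff_space G -> hausdorff_space H.
Proof.
move=> G_T2 x y xy; apply: val_inj; apply: G_T2 => A B xA yB.
have [z [Az Bz]] :=
  xy _ _ (gdelta_val_continuous xA) (gdelta_val_continuous yB).
by exists (\val z).
Qed.

(** A basic two-sided entourage of [H] is the trace of a countable intersection of two-sided
    entourages of [G]. Its preimage is a countable intersection of entourages of [X], and here the
    P-space hypothesis enters. *)
Lemma gdelta_unif_continuous (X : uniformType) (phi : X -> H) :
  uniform_P_space X ->
  unif_continuous_wrt entourage (@two_sided_entourage G) (\val \o phi) ->
  unif_continuous_wrt entourage (@two_sided_entourage H) phi.
Proof.
move=> X_P phi_uc E [A [B [[U [V V1 VU] UA] [U' [V' V'1 VU'] UB] ABE]]].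
pose D n := (fun xy => (\val (phi xy.1), \val (phi xy.2))) @^-1`
  ([set xy | V n (xy.1^-1 * xy.2)] `&` [set xy | V' n (xy.1 * xy.2^-1)]).
apply: (@filterS _ _ _ (\bigcap_n D n)) => [xy Dxy|].
  by apply: ABE; split; [apply: UA; apply: VU|apply: UB; apply: VU'] => n nT;
    have [] := Dxy n nT.
apply: X_P => n; apply: phi_uc.
exists [set xy | V n (xy.1^-1 * xy.2)], [set xy | V' n (xy.1 * xy.2^-1)].
by split=> //; [exists (V n)|exists (V' n)].
Qed.

End GdeltaGenerated.

(** * Consequences of the universal property over a uniform P-space *)

Section UniformFreeGroup.
Context (X : uniformType) (X_P : uniform_P_space X).
Context (F : topologicalGroupType) (i : X -> F).
Context (F_free : is_uniform_free_group i).

(** [Phi] extends the corestriction [j] of [i]. Then [\val \o Phi] and the identity are both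
    continuous endomorphisms of [F] extending [i], so uniqueness identifies them. *)
Lemma uniform_free_group_retraction :
  exists2 Phi : F -> gdelta_generated (range i),
    continuous Phi & cancel Phi \val.
Proof.
have [F_T2 i_uc F_univ] := F_free.
have iS x : i x \in generated (range i).
  apply/asboolP; exists 1%N, [:: i x]; split=> //; last by rewrite big_seq1.
  by move=> y; rewrite mem_seq1 => /eqP ->; left; exists x.
pose j x : gdelta_generated (range i) := exist _ (i x) (iS x).
have j_uc : unif_continuous_wrt entourage (@two_sided_entourage _) j.
  exact: gdelta_unif_continuous.
have [Phi [[Phi_cont PhiM Phij] _]] := F_univ _ j (gdelta_hausdorff F_T2) j_uc.
exists Phi => // x.
have [Psi [_ Psi_uniq]] := F_univ F i F_T2 i_uc.
have PsiE : Psi = \val \o Phi.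
  apply: Psi_uniq; split.
  - move=> y; apply: continuous_comp; first exact: Phi_cont.
    exact: gdelta_val_continuous.
  - by move=> y z /=; rewrite PhiM.
  - by rewrite -compA Phij.
rewrite -[LHS]/((\val \o Phi) x) -PsiE (Psi_uniq id) //.
by split=> // y; exact: cvg_id.
Qed.

(** A countable intersection of neighborhoods is the preimage under the continuous [Phi] of its own
    trace, which is a neighborhood in the finer topology. *)
Lemma uniform_free_group_P_group : P_group F.
Proof.
have [Phi Phi_cont PhiK] := uniform_free_group_retraction.
move=> U U1.
have UPhi : nbhs (Phi 1) (\val @^-1` (\bigcap_n U n)).
  by exists U => // n; rewrite PhiK.
suff <- : Phi @^-1` (\val @^-1` (\bigcap_n U n)) = \bigcap_n U n.
  exact: (Phi_cont 1).
by apply/seteqP; split=> x /=; rewrite PhiK.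
Qed.

Lemma uniform_free_group_generated (x : F) : exists n, word_ball (range i) n x.
Proof.
have [Phi _ PhiK] := uniform_free_group_retraction.
by rewrite -(PhiK x); exact/asboolP/(valP (Phi x)).
Qed.

End UniformFreeGroup.

Theorem theorem4p4 (R : realType) (X : uniformType)
    (X_nonempty : [set: X] !=set0) (X_hausdorff : hausdorff_space X)
    (X_P : uniform_P_space X)
    (F : topologicalGroupType) (i : X -> F)
    (F_free : is_uniform_free_group i) :
  [<-> forall n : nat,
         strongly_functionally_balanced R (word_ball (range i) n);
       forall n : nat, functionally_balanced R (word_ball (range i) n);
       functionally_balanced R [set: F];
       strongly_functionally_balanced R [set: F]].
Proof.
have F_P := uniform_free_group_P_group X_P F_free.
tfae.
- by move=> sfb n; exact: strongly_functionally_balancedW.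
- apply: functionally_balanced_bigcup => //; first exact: word_ball_le.
  exact: uniform_free_group_generated.
- exact: P_group_functionally_balanced_strongly.
- by move=> sfb n; exact: strongly_functionally_balanced_sub.
Qed.
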